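(* Let $t\ge1$ be an integer and let $G=(V,E)$ be a regular graph with $n$ vertices, adjacency matrix $A$ and adjacency eigenvalues $\lambda_1\ge\lambda_2\ge\cdots\ge\lambda_n$ (with multiplicity). Let $p\in\mathbb{R}_t[x]$, put $W(p):=\max_{u\in V}\{(p(A))_{uu}\}$ and $\lambda(p):=\min_{2\le i\le n}\{p(\lambda_i)\}$, and assume $p(\lambda_1)>\lambda(p)$. Then $$\mathrm{eq}_{t+1}(G)\le n\,\frac{W(p)-\lambda(p)}{p(\lambda_1)-\lambda(p)}.$$
   Context: Graphs are finite, simple and undirected; $d(u,v)$ is the shortest-path distance. $\mathbb{R}_t[x]$ is the set of real polynomials of degree at most $t$. A set $S\subseteq V$ is $s$-equidistant if $d(u,v)=s$ for all distinct $u,v\in S$, and $\mathrm{eq}_s(G)$ is the maximum size of an $s$-equidistant set of $G$. *)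

(* Defs.v *)
From mathcomp Require Export all_boot all_order all_algebra.
From mathcomp Require Export reals.

Set Implicit Arguments.
Unset Strict Implicit.
Unset Printing Implicit Defensive.

Import Order.TTheory GRing.Theory Num.Theory.
Local Open Scope ring_scope.

Section Graph.

(* A finite simple graph is a symmetric irreflexive [e : rel T]; symmetry and
   irreflexivity are assumed where needed. *)
Variables (T : finType) (e : rel T).

Definition regular := exists k : nat, forall u : T, #|[set v | e u v]| = k.

Definition has_walk (k : nat) (u v : T) : bool :=
  [exists p : k.-tuple T, path e u p && (last u p == v)].

(* [None] when v is unreachable from u.  Lengths below #|T| suffice because a
   shortest walk repeats no vertex; see [distP]. *)
Definition dist (u v : T) : option nat :=
  ohead [seq k <- iota 0 #|T| | has_walk k u v].

Definition equidistant (s : nat) (S : {set T}) : bool :=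
  [forall u in S, forall v in S, (u != v) ==> (dist u v == Some s)].

Definition eq_num (s : nat) : nat :=
  \max_(S : {set T} | equidistant s S) #|S|.

Lemma has_walk_short k u v :
  has_walk k u v -> exists l, [&& (l < #|T|)%N, (l <= k)%N & has_walk l u v].
Proof.
case/existsP=> p /andP[up]; case/shortenP: up => q uq Uq sub lq.
have sq : (size q <= k)%N.
  rewrite -(size_tuple p); apply: uniq_leq_size => [|x /sub //].
  by case/andP: Uq.
exists (size q); rewrite sq andTb; apply/andP; split.
  by rewrite -[X in (X <= _)%N]/(size (u :: q)) -(card_uniqP Uq) max_card.
by apply/existsP; exists (in_tuple q); rewrite /= uq lq.
Qed.

Lemma distP s u v :
  dist u v = Some s <->
  has_walk s u v /\ (forall k, has_walk k u v -> (s <= k)%N).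
Proof.
rewrite /dist; set r := [seq _ <- _ | _].
have sr : sorted ltn r.
  by apply: sorted_filter (iota_ltn_sorted 0 #|T|); exact: ltn_trans.
have mr k : (k \in r) = has_walk k u v && (k < #|T|)%N.
  by rewrite mem_filter mem_iota add0n.
have key k : has_walk k u v -> exists2 l, l \in r & (l <= k)%N.
  by case/has_walk_short=> l /and3P[l1 l2 l3]; exists l; rewrite // mr l3.
clearbody r; case: r sr mr key => [|x r] /= sr mr key; split=> //.
- by case=> /key[].
- case=> <-; have /andP[xw _] : has_walk x u v && (x < #|T|)%N.
    by rewrite -mr mem_head.
  split=> // k /key[l]; rewrite inE => /orP[/eqP-> //|lr] /(leq_trans _)-> //.
  by have /allP/(_ _ lr)/ltnW := order_path_min ltn_trans sr.
- case=> sw smin; have /andP[xw _] : has_walk x u v && (x < #|T|)%N.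
    by rewrite -mr mem_head.
  congr Some; apply/eqP; rewrite eqn_leq (smin _ xw) andbT.
  have [l] := key _ sw; rewrite inE => /orP[/eqP-> //|lr] /(leq_trans _)-> //.
  by have /allP/(_ _ lr)/ltnW := order_path_min ltn_trans sr.
Qed.

End Graph.

Section Spectral.

Variable R : realType.

Definition adjmx (T : finType) (e : rel T) : 'M[R]_#|T| :=
  \matrix_(i, j) (e (enum_val i) (enum_val j))%:R.

(* [horner_mx] is only available for dimensions of the form n.+1. *)
Definition polymx n (p : {poly R}) (A : 'M[R]_n) : 'M[R]_n :=
  \sum_(i < size p) p`_i *: A ^+ i.

(* Eigenvalues in decreasing order, with multiplicity: the i-th largest one
   is [lam`_i.-1]. *)
Definition is_spectrum n (A : 'M[R]_n) (lam : seq R) : Prop :=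
  sorted >=%R lam /\ char_poly A = \prod_(x <- lam) ('X - x%:P).

(* Both are 0 on the empty sequence. *)
Definition seqmax (s : seq R) : R := \big[Num.max/head 0 s]_(x <- s) x.
Definition seqmin (s : seq R) : R := \big[Num.min/head 0 s]_(x <- s) x.

Definition Wmax (T : finType) (e : rel T) (p : {poly R}) : R :=
  seqmax [seq polymx p (adjmx e) (enum_rank u) (enum_rank u) | u <- enum T].

Definition lammin (lam : seq R) (p : {poly R}) : R :=
  seqmin [seq p.[x] | x <- behead lam].

End Spectral.

(* Main.v *)
(** Let chi be the indicator vector of a (t+1)-equidistant set S of size s.
    Distinct vertices of S are joined by no walk of length at most t, so p(A)
    is diagonal on S and chi p(A) chi^T <= s W(p).  The vector
    w = n chi - s 1 is orthogonal to the all-ones vector 1, an eigenvector for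
    lambda_1, so w p(A) w^T >= lambda(p) |w|^2 by the spectral theorem (used over
    R[i]).  Expanding both sides in chi and 1 gives the bound. *)
Require Import Defs.
From mathcomp Require Import spectral sesquilinear complex lra.

Set Implicit Arguments.
Unset Strict Implicit.
Unset Printing Implicit Defensive.
Import Order.TTheory GRing.Theory Num.Theory.
Local Open Scope ring_scope.
Local Open Scope sesquilinear_scope.

(** * Quadratic forms of normal and of real symmetric matrices *)

Lemma char_poly_similar (F : fieldType) n (P D : 'M[F]_n) :
  P \in unitmx -> char_poly (invmx P *m D *m P) = char_poly D.
Proof.
move=> Pu; pose Pc := map_mx (@polyC F) P; pose Pi := map_mx (@polyC F) (invmx P).
have PiP : Pi *m Pc = 1%:M by rewrite -map_mxM mulVmx // map_mx1.
have -> : char_poly (invmx P *m D *m P) = \det (Pi *m char_poly_mx D *m Pc).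
  rewrite /char_poly; congr (\det _).
  rewrite /char_poly_mx mulmxBr mulmxBl !map_mxM; congr (_ - _).
  by rewrite scalar_mxC -mulmxA PiP mulmx1.
by rewrite !det_mulmx mulrAC -det_mulmx PiP det1 mul1r.
Qed.

(** In an orthonormal eigenbasis both sides become sums of [|y_i|^2], weighted by [m] and by
    [p.[d_i]]. They compare termwise once [y_i] is known to vanish wherever [d_i] is outside [l]. *)
Lemma normal_form_ge (C : numClosedFieldType) n (A : 'M[C]_n.+1) (l0 : C)
    (l : seq C) (u w : 'rV[C]_n.+1) (p : {poly C}) (m : C) :
  A \is normalmx -> char_poly A = \prod_(x <- l0 :: l) ('X - x%:P) ->
  u != 0 -> u *m A = l0 *: u -> w *m u ^t* = 0 ->
  {in l, forall x, m <= p.[x]} ->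
  m * (w *m w ^t*) 0 0 <= (w *m horner_mx A p *m w ^t*) 0 0.
Proof.
move=> /orthomx_spectralP An Achar u0 uA wu0 lp.
move: (spectral_unitarymx A) An; set P := spectralmx A.
set d := spectral_diag A => Pu An.
have Punit := unitarymx_unit Pu.
have invP := invmx_unitary Pu.
pose y := w *m P ^t*; pose z := u *m P ^t*.
have toP v v' : v *m v' ^t* = (v *m P ^t*) *m (v' *m P ^t*) ^t* :> 'M_1.
  rewrite [X in _ = _ *m X](_ : _ = P *m v' ^t*); last first.
    by rewrite trmx_mul map_mxM trmxCK.
  by rewrite -invP mulmxA mulmxKV.
have zE : z *m diag_mx d = l0 *: z.
  by rewrite /z scalemxAl -uA [in RHS]An -invP !mulmxA mulmxK.
have z0 : z != 0.
  apply: contra u0 => /eqP z0.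
  by rewrite -[u](mulmxKV Punit) invP -/z z0 mul0mx.
have yz0 : \sum_i y 0 i * (z 0 i)^* = 0.
  have := congr1 (fun M : 'M_1 => M 0 0) wu0.
  by rewrite toP !mxE => h; rewrite -[RHS]h; apply: eq_bigr => i _; rewrite !mxE.
(* Both lists are the roots of the same split polynomial, hence agree as multisets. *)
have dl : perm_eq [seq d 0 i | i <- enum 'I_n.+1] (l0 :: l).
  apply/prod_XsubC_eq; rewrite -Achar An char_poly_similar //.
  rewrite char_poly_trig ?diag_mx_is_trig // big_map big_enum /=.
  by apply: eq_bigr => i _; rewrite !mxE eqxx.
(* Either [d 0 i] is one of the values in [l], or it is [l0] and simple; then [u]
   spans its eigenspace and [w] has no component along it. *)
have ydl i : y 0 i = 0 \/ d 0 i \in l.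
  case: (boolP (d 0 i \in l)) => [|dil]; [by right | left].
  have il : d 0 i = l0.
    have : d 0 i \in l0 :: l.
      by rewrite -(perm_mem dl); apply: map_f; rewrite mem_enum.
    by rewrite inE (negPf dil) orbF => /eqP.
  have zj j : j != i -> z 0 j = 0.
    (* Removing the index [i] on one side and one copy of [l0] on the other leaves [l] as the
       remaining diagonal entries. Since [l0] is not in [l], [d 0 j] differs from [l0], and [zE]
       forces [z 0 j = 0]. *)
    move=> ji; have : d 0 j \in l.
      have iin : i \in enum 'I_n.+1 by rewrite mem_enum.
      have := perm_map (fun i => d 0 i) (perm_to_rem iin).
      rewrite perm_sym => /perm_trans/(_ dl) /=.
      rewrite il perm_cons => /perm_mem <-.
      by apply: map_f; rewrite mem_rem_uniq ?enum_uniq // inE ji mem_enum.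
    move=> djl; have := congr1 (fun M : 'rV_ _ => M 0 j) zE.
    rewrite mul_mx_diag !mxE mulrC => /eqP.
    rewrite -subr_eq0 -mulrBl mulf_eq0 subr_eq0 => /orP[/eqP dj|/eqP //].
    by rewrite il -dj djl in dil.
  have zi : z 0 i != 0.
    apply: contra z0 => /eqP zi; apply/eqP/rowP => j; rewrite [RHS]mxE.
    by have [->|/zj] := eqVneq j i.
  move: yz0; rewrite (bigD1 i) //= big1 ?addr0 => [/eqP|j /zj->].
    by rewrite mulf_eq0 conjC_eq0 (negPf zi) orbF => /eqP.
  by rewrite rmorph0 mulr0.
have -> : w *m horner_mx A p *m w ^t* =
    y *m diag_mx (map_mx (horner p) d) *m y ^t*.
  rewrite An horner_mx_uconjC // horner_mx_diag invP /y.
  by rewrite trmx_mul map_mxM trmxCK !mulmxA.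
rewrite (toP w w) -/y; move: ydl; clearbody y => ydl.
rewrite !mxE mulr_sumr ler_sum // => i _.
rewrite mul_mx_diag !mxE.
have [->|dil] := ydl i; first by rewrite !mul0r mulr0.
by rewrite [leRHS]mulrAC [leRHS]mulrC ler_wpM2r ?mul_conjC_ge0 ?lp.
Qed.

(** Over [R[i]] a symmetric matrix with real entries is normal and conjugation fixes those entries;
    the inequality returns to [R] because the embedding reflects the order. *)
Lemma symmetric_form_ge (R : rcfType) n (A : 'M[R]_n.+1) (l0 : R) (l : seq R)
    (u w : 'rV[R]_n.+1) (p : {poly R}) (m : R) :
  A^T = A -> char_poly A = \prod_(x <- l0 :: l) ('X - x%:P) ->
  u != 0 -> u *m A = l0 *: u -> w *m u^T = 0 ->
  {in l, forall x, m <= p.[x]} ->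
  m * (w *m w^T) 0 0 <= (w *m horner_mx A p *m w^T) 0 0.
Proof.
move=> At Achar u0 uA wu0 lp; pose f := real_complex R.
have ftC k (v : 'rV[R]_k) : (map_mx f v) ^t* = map_mx f v^T.
  by apply/matrixP => i j; rewrite !mxE -[LHS]/(conjc _) conjc_real.
have AR : map_mx f A \is normalmx.
  apply: symmetric_normalmx.
    by apply/is_hermitianmxP; rewrite expr0 scale1r map_mx_id ?map_trmx ?At //.
  by apply/mxOverP => i j; rewrite !mxE; apply/complex_realP; exists (A i j).
have := @normal_form_ge _ _ (map_mx f A) (f l0) (map f l) (map_mx f u)
  (map_mx f w) (map_poly f p) (f m) AR.
rewrite !ftC -map_horner_mx -!map_mxM [X in _ <= X]mxE [X in _ * X]mxE.
rewrite -rmorphM lecR; apply.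
- by rewrite -map_char_poly Achar map_prod_XsubC -map_cons big_map.
- by rewrite map_mx_eq0.
- by rewrite uA map_mxZ.
- by rewrite wu0 map_mx0.
- by move=> _ /mapP[x xl ->]; rewrite horner_map lecR lp.
Qed.

(** * Polynomials in a real matrix *)

Lemma polymxE (R : realType) n (p : {poly R}) (A : 'M[R]_n.+1) :
  polymx p A = horner_mx A p.
Proof.
rewrite -[p in RHS]coefK poly_def raddf_sum; apply: eq_bigr => i _.
by rewrite /= horner_mxZ rmorphXn /= horner_mx_X.
Qed.

Lemma polymx_form_ge (R : realType) n (A : 'M[R]_n) (l0 : R) (l : seq R)
    (u w : 'rV[R]_n) (p : {poly R}) (m : R) :
  A^T = A -> char_poly A = \prod_(x <- l0 :: l) ('X - x%:P) ->
  u != 0 -> u *m A = l0 *: u -> w *m u^T = 0 ->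
  {in l, forall x, m <= p.[x]} ->
  m * (w *m w^T) 0 0 <= (w *m polymx p A *m w^T) 0 0.
Proof.
(* In dimension 0 the hypothesis [u != 0] is contradictory. *)
case: n A u w => [A u w _ _ /eqP[]|n A u w]; first by apply/rowP => -[].
by rewrite polymxE; apply: symmetric_form_ge.
Qed.

Lemma polymx_eigenvec (R : realType) n (A : 'M[R]_n) (v : 'rV[R]_n) (a : R)
    (p : {poly R}) :
  v *m A = a *: v -> v *m polymx p A = p.[a] *: v.
Proof.
move=> vA; have vAk k : v *m A ^+ k = a ^+ k *: v.
  elim: k => [|k IH]; first by rewrite !expr0 mulmx1 scale1r.
  by rewrite exprSr -mulmxE mulmxA IH -scalemxAl vA scalerA exprSr.
rewrite mulmx_sumr horner_coef scaler_suml; apply: eq_bigr => i _.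
by rewrite -scalemxAr vAk scalerA.
Qed.

Lemma polymx_tr (R : realType) n (A : 'M[R]_n) (p : {poly R}) :
  A^T = A -> (polymx p A)^T = polymx p A.
Proof.
move=> At; have Atk k : (A ^+ k)^T = A ^+ k.
  elim: k => [|k IH]; first by rewrite expr0 trmx1.
  by rewrite {1}exprS -mulmxE trmx_mul IH At exprSr.
by rewrite linear_sum; apply: eq_bigr => i _; rewrite linearZ /= Atk.
Qed.

(** * Adjacency matrices: walks, equidistant sets and regularity *)

Lemma adjmx_tr (R : realType) (T : finType) (e : rel T) :
  symmetric e -> (adjmx R e)^T = adjmx R e.
Proof. by move=> es; apply/matrixP => i j; rewrite !mxE es. Qed.

(** A nonzero entry of [A * A ^+ k] has a nonzero summand, whose index [l] gives the first step of
    the walk. *)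
Lemma adjmx_exp_neq0 (R : realType) (T : finType) (e : rel T) k (i j : 'I_#|T|) :
  (adjmx R e ^+ k) i j != 0 -> has_walk e k (enum_val i) (enum_val j).
Proof.
elim: k i => [|k IH] i.
  rewrite expr0 mxE; have [->|_] := eqVneq i j; last by rewrite eqxx.
  by move=> _; apply/existsP; exists [tuple]; rewrite /= eqxx.
rewrite exprS -mulmxE mxE => s0.
have /existsP[l] : [exists l, adjmx R e i l * (adjmx R e ^+ k) l j != 0].
  apply: contraNT s0 => /existsPn h; rewrite big1 // => l _.
  by apply/eqP; rewrite -[_ == _]negbK h.
rewrite mulf_eq0 negb_or mxE => /andP[eil /IH /existsP[q /andP[pq lq]]].
apply/existsP; exists [tuple of enum_val l :: q]; rewrite /= pq lq !andbT.
by move: eil; case: (e _ _) => //; rewrite eqxx.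
Qed.

(** Distance [t.+1] excludes walks of length at most [t], and only powers up to [t] occur in [p]. *)
Lemma polymx_adjmx_equidistant (R : realType) (T : finType) (e : rel T) t
    (p : {poly R}) (S : {set T}) u v :
  (size p <= t.+1)%N -> equidistant e t.+1 S -> u \in S -> v \in S -> u != v ->
  polymx p (adjmx R e) (enum_rank u) (enum_rank v) = 0.
Proof.
move=> sp /forall_inP /[apply] /forall_inP /[apply] /implyP /[apply].
move=> /eqP/distP[_ dmin]; rewrite summxE big1 // => i _; rewrite mxE.
apply/eqP; rewrite mulf_eq0; apply/orP; right; apply/negPn/negP.
move=> /adjmx_exp_neq0; rewrite !enum_rankK => /dmin.
by rewrite leqNgt (leq_trans (ltn_ord i) sp).
Qed.

Lemma adjmx_regular (R : realType) (T : finType) (e : rel T) k :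
  symmetric e -> (forall u : T, #|[set v | e u v]| = k) ->
  const_mx 1 *m adjmx R e = k%:R *: const_mx 1 :> 'rV_#|T|.
Proof.
move=> es reg; apply/rowP => j; rewrite !mxE mulr1 -(reg (enum_val j)).
under eq_bigr do rewrite !mxE mul1r es.
rewrite -sum1_card natr_sum [RHS]big_mkcond /= (reindex (@enum_val T T)) /=.
  by apply: eq_bigr => i _; rewrite inE; case: (e _ _).
by apply: onW_bij; apply: enum_val_bij.
Qed.

(** At a coordinate [j] where the eigenvector is largest in absolute value, [a |v_j|] is at most the
    sum of [|v_i|] over the [k] neighbours of [j], hence at most [k |v_j|]. *)
Lemma adjmx_regular_eigenvalue_le (R : realType) (T : finType) (e : rel T) k a :
  symmetric e -> (forall u : T, #|[set v | e u v]| = k) ->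
  eigenvalue (adjmx R e) a -> a <= k%:R.
Proof.
move=> es reg /eigenvalueP[v va v0].
have /existsP[i0 vi0] : [exists i, v 0 i != 0].
  apply: contraNT v0 => /existsPn h; apply/eqP/rowP => i; rewrite mxE.
  by apply/eqP; rewrite -[_ == _]negbK h.
case: (@arg_maxP _ _ _ i0 xpredT (fun i => `|v 0 i|)) => // j _ jmax.
have vj : 0 < `|v 0 j| by rewrite (lt_le_trans _ (jmax i0 isT)) ?normr_gt0.
rewrite -(ler_pM2r vj); apply: (@le_trans _ _ `|a * v 0 j|).
  by rewrite normrM ler_wpM2r ?ler_norm.
have -> : a * v 0 j = \sum_i v 0 i * adjmx R e i j.
  by have := congr1 (fun M : 'rV_ _ => M 0 j) va; rewrite !mxE => <-.
have := congr1 (fun M : 'rV_ _ => M 0 j) (adjmx_regular R es reg).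
rewrite !mxE mulr1 => <-; rewrite mulr_suml.
apply: le_trans (ler_norm_sum _ _ _) _; apply: ler_sum => i _.
rewrite normrM !mxE mul1r normr_nat [leRHS]mulrC.
by apply: ler_wpM2r (jmax _ isT); rewrite ler0n.
Qed.

(** * Extrema over finite sequences and families *)

Lemma seqmin_le (R : realType) (s : seq R) x : x \in s -> seqmin s <= x.
Proof.
(* The initial value [head 0 s] changes with [s], so the induction generalises it to any [h]. *)
rewrite /seqmin; elim: s (head 0 s) => // y s IH h; rewrite inE big_cons ge_min.
by case/orP => [/eqP->|/IH->]; rewrite ?lexx ?orbT.
Qed.

Lemma seqmax_ge (R : realType) (s : seq R) x : x \in s -> x <= seqmax s.
Proof.
rewrite /seqmax; elim: s (head 0 s) => // y s IH h; rewrite inE big_cons le_max.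
by case/orP => [/eqP->|/IH->]; rewrite ?lexx ?orbT.
Qed.

(** A singleton is vacuously equidistant, so the maximum runs over a nonempty family and is at least
    1. *)
Lemma eq_num_witness (T : finType) (e : rel T) s (x : T) :
  exists S : {set T}, [/\ equidistant e s S, #|S| = eq_num e s & (0 < #|S|)%N].
Proof.
have xe : equidistant e s [set x].
  apply/forall_inP => u /set1P->; apply/forall_inP => v /set1P->.
  by rewrite eqxx.
have [] := @eq_bigmax_cond _ (equidistant e s) (fun S => #|S|).
  by apply/card_gt0P; exists [set x].
move=> S Se SE; exists S; split=> //; rewrite -SE.
by rewrite (leq_trans _ (leq_bigmax_cond _ xe)) ?cards1.
Qed.

Theorem proposition16 (R : realType) (t : nat) (ht : (1 <= t)%N)
    (T : finType) (e : rel T) (e_sym : symmetric e) (e_irr : irreflexive e)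
    (e_reg : regular e) (n : nat) (hn : #|T| = n) (n_ge2 : (2 <= n)%N)
    (lam : seq R) (hlam : is_spectrum (adjmx R e) lam)
    (p : {poly R}) (hp : (size p <= t.+1)%N)
    (hgap : lammin lam p < p.[lam`_0]) :
  (eq_num e t.+1)%:R
    <= n%:R * ((Wmax e p - lammin lam p) / (p.[lam`_0] - lammin lam p)).
Proof.
case: hlam => lam_sorted lam_char; case: e_reg => k reg.
case: lam lam_sorted lam_char hgap => [_ char_1|l0 l l_sorted lchar /=].
  (* The characteristic polynomial has degree [n], so the spectrum is not empty. *)
  have := size_char_poly (adjmx R e); rewrite char_1 big_nil size_poly1 hn.
  by case=> n0; rewrite -n0 in n_ge2.
set m := lammin _ p; set W := Wmax e p => gap.
set A := adjmx R e in lchar *; set one : 'rV[R]_#|T| := const_mx 1.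
have At : A^T = A := adjmx_tr R e_sym.
have /card_gt0P[x0 _] : (0 < #|T|)%N by rewrite hn ltnW.
have one0 : one != 0.
  apply/eqP => /rowP/(_ (enum_rank x0)); rewrite !mxE => /eqP.
  by rewrite oner_eq0.
have oneA : one *m A = k%:R *: one := adjmx_regular R e_sym reg.
have in_lam a : (a \in l0 :: l) = eigenvalue A a.
  by rewrite eigenvalue_root_char lchar root_prod_XsubC.
(* The degree bounds every eigenvalue and is itself one, with eigenvector [one], so it heads the
   decreasing list. *)
have l0k : l0 = k%:R.
  apply/eqP; rewrite eq_le; apply/andP; split.
    by apply: adjmx_regular_eigenvalue_le e_sym reg _; rewrite -in_lam mem_head.
  have : k%:R \in l0 :: l by rewrite in_lam; apply/eigenvalueP; exists one.
  rewrite inE => /predU1P[->//|kl].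
  by have /allP := order_path_min ge_trans l_sorted; apply.
have lp : {in l, forall x, m <= p.[x]}.
  by move=> x xl; apply: seqmin_le; apply: map_f.
have [S [Seq <- S0]] := eq_num_witness e t.+1 x0; set s := #|S| in S0 *.
pose chi : 'rV[R]_#|T| := \row_i (enum_val i \in S)%:R.
have sumS (F : T -> R) : \sum_(i < #|T|) (enum_val i \in S)%:R * F (enum_val i)
    = \sum_(u in S) F u.
  rewrite [RHS]big_mkcond /= (reindex (@enum_val T T)) /=.
    by apply: eq_bigr => i _; case: (_ \in S); rewrite ?mul1r ?mul0r.
  by apply: onW_bij; apply: enum_val_bij.
have chi1 : (chi *m one^T) 0 0 = s%:R.
  rewrite mxE -[s]sum1_card natr_sum -sumS.
  by apply: eq_bigr => i _; rewrite !mxE.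
have chichi : (chi *m chi^T) 0 0 = s%:R.
  rewrite mxE -[s]sum1_card natr_sum -sumS.
  by apply: eq_bigr => i _; rewrite !mxE; case: (_ \in S); rewrite ?mul0r.
have oneone : (one *m one^T) 0 0 = n%:R.
  rewrite mxE (eq_bigr (fun=> 1)) ?sumr_const ?card_ord ?hn // => i _.
  by rewrite !mxE mulr1.
have onechi : (one *m chi^T) 0 0 = s%:R.
  by rewrite -chi1 -[one *m _]trmxK trmx_mul trmxK mxE.
set P := polymx p A.
have chiP : (chi *m P *m chi^T) 0 0 <= s%:R * W.
  pose F v := \sum_(u in S) P (enum_rank u) (enum_rank v).
  have -> : (chi *m P *m chi^T) 0 0 = \sum_(v in S) F v.
    rewrite mxE -sumS; apply: eq_bigr => j _; rewrite mulrC 2!mxE; congr (_ * _).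
    by rewrite mxE /F -sumS; apply: eq_bigr => i _; rewrite [chi _ _]mxE !enum_valK.
  rewrite -[s]sum1_card natr_sum mulr_suml; apply: ler_sum => v vS.
  (* Within [S] the off-diagonal entries of [P] vanish; the entry at [v] remains, and it is at most
     [W]. *)
  rewrite /F (bigD1 v) //= big1 ?addr0 ?mul1r.
    by apply: seqmax_ge; apply: map_f; rewrite mem_enum.
  by move=> u /andP[uS uv]; apply: polymx_adjmx_equidistant hp Seq _ _ _.
have oneP : one *m P = p.[l0] *: one.
  by rewrite l0k; apply: polymx_eigenvec.
have Pone : P *m one^T = p.[l0] *: one^T.
  by rewrite -[P]trmxK polymx_tr // -trmx_mul oneP linearZ.
(* A multiple of the component of [chi] orthogonal to [one], free of division: [chi] and [one] have
   inner product [s], and [one] has squared norm [n]. *)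
pose w := n%:R *: chi - s%:R *: one.
have wX (X : 'cV[R]_#|T|) :
    (w *m X) 0 0 = n%:R * (chi *m X) 0 0 - s%:R * (one *m X) 0 0.
  by rewrite mulmxBl -!scalemxAl !mxE.
have w1 : w *m one^T = 0.
  by apply/matrixP => i j; rewrite !ord1 wX chi1 oneone mxE mulrC subrr.
(* Applied to [w] and to [w *m P], so that only the [chi] part of the right-hand factor has to be
   expanded. *)
have wT (X : 'rV[R]_#|T|) : X *m one^T = 0 ->
    (X *m w^T) 0 0 = n%:R * (X *m chi^T) 0 0.
  move=> X1; rewrite [w^T]linearB /= 2![(_ *: _)^T]linearZ /= mulmxBr.
  by rewrite -!scalemxAr X1 scaler0 subr0 mxE.
have l0A : one *m A = l0 *: one by rewrite l0k.
have := polymx_form_ge At lchar one0 l0A w1 lp; rewrite -/P.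
have wP1 : w *m P *m one^T = 0 by rewrite -mulmxA Pone -scalemxAr w1 scaler0.
rewrite !wT // -mulmxA !wX !mulmxA chichi onechi oneP -scalemxAl.
rewrite [(_ *: (_ : 'M[R]_1) : 'M_1) 0 0]mxE onechi [leLHS]mulrCA.
set Q := p.[l0] in gap *; have n0 : 0 < n%:R :> R by rewrite ltr0n ltnW.
have sR0 : 0 < s%:R :> R by rewrite ltr0n.
rewrite ler_pM2l // => key.
rewrite mulrA ler_pdivlMr ?subr_gt0 // -(ler_pM2l sR0).
(* Bounding the form at [chi] by [s W] turns [key] into [m (n s - s^2) <= n s W - s^2 Q], a
   rearrangement of the goal, which now carries a factor [s] on both sides. *)
have := le_trans key (lerB (ler_wpM2l (ltW n0) chiP) (lexx _)).
nra.
Qed.
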